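(* For integers $n,m\geq 1$ let $H^t(n,m)$, $H^c(n,m)$, $H^f(n,m)$ be the hexagonal lattices with toroidal, cylindrical and free boundary conditions defined below. Then, as $n$ and $m$ both tend to infinity, $$\lim_{n,m\rightarrow \infty}\frac{\mathcal E(H^t(n,m))}{2nm}=\lim_{n,m\rightarrow \infty}\frac{\mathcal E(H^c(n,m))}{2nm}=\lim_{n,m\rightarrow \infty}\frac{\mathcal E(H^f(n,m))}{2nm}=\frac{1}{4\pi^2}\int_0^{2\pi}\int_0^{2\pi}\sqrt{3+2\cos x+2\cos y+2\cos (x+y)}\,dx\,dy .$$
   Context: For a finite simple graph $G$ with adjacency matrix $A(G)$, the energy $\mathcal E(G)$ is the sum of the absolute values of all eigenvalues of $A(G)$ (counted with multiplicity). Let $N=n+1$ and $M=m+1$. All three graphs have vertex set $\{0,\dots,N-1\}\times\{0,\dots,2M-1\}$ ($2(n+1)(m+1)$ vertices). The toroidal hexagonal lattice $H^t(n,m)$ has edges: $(i,j)\sim(i,j+1\bmod 2M)$ for all $i,j$ (each column $i$ forms a cycle of length $2M$), and $(i,2k+1)\sim(i+1\bmod N,2k)$ for all $i$ and $0\le k\le M-1$; it is $3$-regular. The cylindrical lattice $H^c(n,m)$ is obtained from $H^t(n,m)$ by deleting the $N$ edges $(i,2M-1)\sim(i,0)$, $0\le i\le N-1$. The free lattice $H^f(n,m)$ is obtained from $H^c(n,m)$ by further deleting the $M$ edges $(N-1,2k+1)\sim(0,2k)$, $0\le k\le M-1$. The limit $n,m\to\infty$ is the joint limit. *)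

(* Defs.v *)
From mathcomp Require Import all_boot all_order all_algebra.
From mathcomp Require Import all_classical all_reals all_analysis.

Set Implicit Arguments.
Unset Strict Implicit.
Unset Printing Implicit Defensive.

Import Order.TTheory GRing.Theory Num.Theory.
Import numFieldNormedType.Exports.

Local Open Scope classical_set_scope.
Local Open Scope ring_scope.

Definition adjmx (R : realType) (T : finType) (e : rel T) : 'M[R]_#|T| :=
  \matrix_(i, j) (e (enum_val i) (enum_val j))%:R.

(* Intended for symmetric [e]: the adjacency matrix is then real symmetric, so
   its real eigenvalues, counted with multiplicity, are all its eigenvalues. *)
Definition energy (R : realType) (T : finType) (e : rel T) : R :=
  let A := adjmx R e in
  \sum_(x \in [set x : R | eigenvalue A x])
    (mup x (char_poly A))%:R * `|x|.

Definition symclosure (T : Type) (e : rel T) : rel T :=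
  fun u v => e u v || e v u.

Section HexagonalLattice.
Variables n m : nat.
Local Open Scope nat_scope.

Definition hexV : finType := ('I_n.+1 * 'I_(2 * m.+1))%type.

Implicit Types u v : hexV.

(* (i, j) -> (i, j + 1 mod 2M) *)
Definition vert_arc : rel hexV := fun u v =>
  (v.1 == u.1) && (v.2 == u.2.+1 %% (2 * m.+1) :> nat).

(* (i, 2k + 1) -> (i + 1 mod N, 2k) *)
Definition hor_arc : rel hexV := fun u v =>
  (v.1 == u.1.+1 %% n.+1 :> nat) &&
  [exists k : 'I_m.+1, (u.2 == 2 * k + 1 :> nat) && (v.2 == 2 * k :> nat)].

(* (i, 2M - 1) -> (i, 0) *)
Definition vert_wrap_arc : rel hexV := fun u v =>
  (v.1 == u.1) && (u.2 == 2 * m.+1 - 1 :> nat) && (v.2 == 0 :> nat).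

(* (N - 1, 2k + 1) -> (0, 2k) *)
Definition hor_wrap_arc : rel hexV := fun u v =>
  (u.1 == n :> nat) && (v.1 == 0 :> nat) &&
  [exists k : 'I_m.+1, (u.2 == 2 * k + 1 :> nat) && (v.2 == 2 * k :> nat)].

(* These are simple graphs, and the torus is 3-regular, when 1 <= n and
   1 <= m; for n = 0 or m = 0 the edges below may coincide. *)
Definition hex_torus : rel hexV := fun u v =>
  symclosure vert_arc u v || symclosure hor_arc u v.

Definition hex_cylinder : rel hexV := fun u v =>
  hex_torus u v && ~~ symclosure vert_wrap_arc u v.

Definition hex_free : rel hexV := fun u v =>
  hex_cylinder u v && ~~ symclosure hor_wrap_arc u v.

End HexagonalLattice.

(* Main.v *)
(** For real symmetric [A] and [B], if [s i] is the sign of the i-th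
    eigenvalue of [A] and [u i] is an orthonormal eigenbasis of [A], then
    E(A) = sum_i s i <u i, A u i>; replacing [A] by [B] in the right-hand side
    changes it by at most the sum of the |A j k - B j k|, and turns it into a
    quantity bounded by E(B), since the squared moduli of the entries of a
    unitary matrix sum to 1 along rows and columns.  So deleting the O(n + m)
    wrapping edges changes the energy by O(n + m), which is negligible with
    respect to nm, and only the torus matters.  Its adjacency matrix is
    diagonalised by the characters of Z/N x Z/M: the momentum (x, y)
    contributes the two eigenvalues +|f| and -|f|, where
    f = 1 + e^(ix) + e^(-iy) and
    |f|^2 = 3 + 2 cos x + 2 cos y + 2 cos (x + y).  The energy is therefore a
    Riemann sum, of a function which is 1/2-Hoelder in each variable. *)

Require Import Defs.
From mathcomp Require Import all_boot all_order all_algebra.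
From mathcomp Require Import all_classical all_reals all_analysis.
From mathcomp Require Import complex.
From mathcomp Require Import zify ring lra.

Set Implicit Arguments.
Unset Strict Implicit.
Unset Printing Implicit Defensive.

Import Order.TTheory GRing.Theory Num.Theory.
Import numFieldNormedType.Exports.

Local Open Scope classical_set_scope.
Local Open Scope ring_scope.

(** * Energy via diagonalisation, and its stability under perturbation *)

Section Energy.
Variables (R : realType) (T : finType).
Local Notation C := R[i].
Local Notation toC := (real_complex R).
Implicit Types (e : rel T) (n : nat).
Local Open Scope sesquilinear_scope.

(** The relation lifts to polynomial matrices as (X - A) P = P (X - D); taking determinants, the
    nonzero constant det P cancels. *)
Lemma char_poly_similar_diag (F : fieldType) n (A P : 'M[F]_n) (d : 'rV[F]_n) :
  P \in unitmx -> A *m P = P *m diag_mx d ->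
  char_poly A = \prod_(i < n) ('X - (d 0 i)%:P).
Proof.
move=> Pu AP.
have -> : \prod_(i < n) ('X - (d 0 i)%:P) = char_poly (diag_mx d).
  rewrite char_poly_trig ?diag_mx_is_trig//.
  by apply: eq_bigr => i _; rewrite mxE eqxx mulr1n.
rewrite /char_poly /char_poly_mx.
set Q := map_mx (@polyC F) P.
have Qu : \det Q != 0.
  by rewrite det_map_mx polyC_eq0 -unitfE -unitmxE.
apply: (mulIf Qu); rewrite -det_mulmx [RHS]mulrC -det_mulmx.
rewrite mulmxBl mulmxBr -map_mxM AP map_mxM/=.
by rewrite -[in LHS]scalar_mxC.
Qed.

(** The multiplicity of a root is the number of indices at which [d] takes that value, so grouping
    the right-hand sum by values gives the left-hand one. *)
Lemma sum_mup_codom n (p : {poly R}) (d : 'I_n -> R) :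
  p = \prod_(i < n) ('X - (d i)%:P) ->
  \sum_(x \in [set x : R | root p x]) (mup x p)%:R * `|x| = \sum_(i < n) `|d i|.
Proof.
move=> pE; set s := [seq d i | i <- enum 'I_n].
have ps : p = \prod_(y <- s) ('X - y%:P) by rewrite big_map big_enum.
have -> : [set x | root p x] = [set` undup s].
  by apply/seteqP; split => x /=; rewrite mem_undup ps root_prod_XsubC.
rewrite -fsbig_seq ?undup_uniq//.
transitivity (\sum_(x <- s) `|x|); last by rewrite big_map big_enum.
rewrite -[RHS]big_undup_iterop_count.
by apply: eq_bigr => x _; rewrite ps mu_prod_XsubC mulr_natl.
Qed.

(** The eigenvectors may be complex although the energy is defined over [R]: the factorisation of
    the characteristic polynomial descends because [toC] is injective on polynomials. *)
Lemma energy_diag e (P : 'M[C]_#|T|) (d : 'I_#|T| -> R) :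
  P \in unitmx ->
  map_mx toC (adjmx R e) *m P = P *m diag_mx (\row_i (d i)%:C%C) ->
  energy R e = \sum_i `|d i|.
Proof.
move=> Pu /(char_poly_similar_diag Pu) cp.
rewrite /energy; set A := adjmx R e.
have -> : [set x | eigenvalue A x] = [set x | root (char_poly A) x].
  by apply/seteqP; split => x /=; rewrite eigenvalue_root_char.
apply: sum_mup_codom; apply: (map_poly_inj toC).
rewrite map_char_poly cp rmorph_prod; apply: eq_bigr => i _.
by rewrite mxE rmorphB /= map_polyX map_polyC.
Qed.

Lemma unitary_row_norm (K : numClosedFieldType) n (U : 'M[K]_n) i :
  U \is unitarymx -> \sum_k `|U i k| ^+ 2 = 1.
Proof.
move=> /unitarymxP/matrixP/(_ i i); rewrite !mxE eqxx mulr1n => <-.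
by apply: eq_bigr => k _; rewrite !mxE normCK.
Qed.

Lemma unitary_col_norm (K : numClosedFieldType) n (U : 'M[K]_n) k :
  U \is unitarymx -> \sum_i `|U i k| ^+ 2 = 1.
Proof.
move=> Uu; rewrite -[RHS](@unitary_row_norm _ _ U^T k) ?trmx_unitary//.
by apply: eq_bigr => i _; rewrite mxE.
Qed.

(** The i-th diagonal entry is the average of [d] with weights |U i k|^2, and for fixed k these
    weights sum to 1 over i. *)
Lemma unitary_diag_trace_le (K : numClosedFieldType) n (U : 'M[K]_n)
    (d : 'rV[K]_n) :
  U \is unitarymx ->
  \sum_i `|(U *m diag_mx d *m U^t*) i i| <= \sum_k `|d 0 k|.
Proof.
move=> Uu.
apply: (@le_trans _ _ (\sum_i \sum_k `|U i k| ^+ 2 * `|d 0 k|)).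
  apply: ler_sum => i _; rewrite mxE; apply: le_trans (ler_norm_sum _ _ _) _.
  apply: ler_sum => k _; rewrite mul_mx_diag !mxE.
  by rewrite mulrAC -normCK normrM normrX normr_id.
rewrite exchange_big/=; apply: ler_sum => k _.
by rewrite -mulr_suml unitary_col_norm// mul1r.
Qed.

(** In the expanded diagonal entries, |B j k| has weight |U i j| |U i k|, at most half the sum of
    the squares; summed over i this bound is 1. *)
Lemma unitary_entries_le (K : numClosedFieldType) n (U B : 'M[K]_n) :
  U \is unitarymx ->
  \sum_i `|(U *m B *m U^t*) i i| <= \sum_j \sum_k `|B j k|.
Proof.
move=> Uu.
have amgm (x y : K) : `|x| * `|y| <= (`|x| ^+ 2 + `|y| ^+ 2) / 2.
  have xyr : `|x| - `|y| \is Num.real by rewrite realB ?normr_real.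
  rewrite ler_pdivlMr// -subr_ge0.
  rewrite (_ : _ - _ = (`|x| - `|y|) ^+ 2); last by ring.
  by rewrite real_exprn_even_ge0.
apply: (@le_trans _ _ (\sum_i \sum_k \sum_j
    `|B j k| * ((`|U i j| ^+ 2 + `|U i k| ^+ 2) / 2))).
  apply: ler_sum => i _; rewrite mxE; apply: le_trans (ler_norm_sum _ _ _) _.
  apply: ler_sum => k _; rewrite !mxE mulr_suml.
  apply: le_trans (ler_norm_sum _ _ _) _.
  apply: ler_sum => j _; rewrite !normrM norm_conjC mulrAC [leLHS]mulrC.
  by rewrite ler_wpM2l.
rewrite exchange_big/= [leRHS]exchange_big/=; apply: ler_sum => k _.
rewrite exchange_big/=; apply: ler_sum => j _.
rewrite -mulr_sumr -mulr_suml big_split/= !unitary_col_norm//.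
by rewrite divff// mulr1.
Qed.

Lemma energy_spectral e (U := spectralmx (map_mx toC (adjmx R e))) :
  symmetric e ->
  exists d : 'I_#|T| -> R, [/\ U \is unitarymx,
    map_mx toC (adjmx R e) = U^t* *m diag_mx (\row_i (d i)%:C%C) *m U &
    energy R e = \sum_i `|d i|].
Proof.
move=> se; set A := map_mx toC (adjmx R e) in U *.
have Ah : A \is hermsymmx.
  apply/is_hermitianmxP; rewrite expr0 scale1r; apply/matrixP => i j.
  rewrite !mxE se; case: (e _ _) => /=; first by rewrite rmorph1 conjC1.
  by rewrite rmorph0 conjC0.
have /hermitian_normalmx/orthomx_spectralP AE := Ah.
have /mxOverP dr := hermitian_spectral_diag_real Ah.
have Uu : U \is unitarymx by exact: spectral_unitarymx.
rewrite -/U invmx_unitary// in AE.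
set sd := spectral_diag A in AE dr.
have dE : sd = \row_i (complex.Re (sd 0 i))%:C%C.
  by apply/rowP => i; rewrite mxE RRe_real.
exists (fun i => complex.Re (sd 0 i)); split => //; first by rewrite -dE.
apply: (@energy_diag _ (U^t*)); first by rewrite unitarymx_unit// trmxC_unitary.
by rewrite -dE -/A [in LHS]AE mulmxtVK.
Qed.

Lemma energy_le_add e1 e2 : symmetric e1 -> symmetric e2 ->
  energy R e1 <= energy R e2 +
    \sum_u \sum_v `|(e1 u v)%:R - (e2 u v)%:R|.
Proof.
move=> /energy_spectral[d1]; set U1 := spectralmx _ => -[U1u A1E ->].
move=> /energy_spectral[d2]; set U2 := spectralmx _ => -[U2u A2E ->].
set A1 := map_mx _ _ in A1E; set A2 := map_mx _ _ in A2E.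
rewrite -lecR rmorphD !rmorph_sum/=.
(* Conjugation by [U1] makes [A1] diagonal with entries [d1 i]; moduli of diagonal entries play the
   part of the signs. *)
have -> : \sum_i (`|d1 i|)%:C%C =
    \sum_i `|(U1 *m (A2 + (A1 - A2)) *m U1^t*) i i|.
  apply: eq_bigr => i _; rewrite addrC subrK A1E !mulmxA (unitarymxP U1u) mul1mx.
  rewrite -mulmxA (unitarymxP U1u) mulmx1 !mxE eqxx mulr1n normc_def/=.
  by rewrite expr0n addr0 sqrtr_sqr.
rewrite mulmxDr mulmxDl.
apply: (@le_trans _ _ (\sum_i `|(U1 *m A2 *m U1^t*) i i| +
                       \sum_i `|(U1 *m (A1 - A2) *m U1^t*) i i|)).
  rewrite -big_split/=; apply: ler_sum => i _.
  by rewrite [X in `|X| <= _]mxE ler_normD.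
apply: lerD.
  (* The change of basis between the two eigenbases is unitary, so the trace bound applies to the
     spectrum [d2]. *)
  set W := U1 *m U2^t*.
  have -> : U1 *m A2 *m U1^t* = W *m diag_mx (\row_i (d2 i)%:C%C) *m W^t*.
    by rewrite A2E /W trmx_mul map_mxM map_trmx trmxK -map_mx_comp
      (map_mx_id (@conjCK _)) !mulmxA.
  apply: le_trans (unitary_diag_trace_le _ _) _.
    by rewrite mul_unitarymx ?trmxC_unitary.
  apply: ler_sum => i _; rewrite mxE normc_def/= expr0n addr0 sqrtr_sqr//.
apply: le_trans (unitary_entries_le _ U1u) _.
rewrite (reindex (@enum_val T predT))/=; last exact/onW_bij/enum_val_bij.
apply: ler_sum => i _; rewrite rmorph_sum/=.
rewrite [leRHS](reindex (@enum_val T predT))/=; last exact/onW_bij/enum_val_bij.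
apply: ler_sum => j _; rewrite !mxE -rmorphB normc_def/= expr0n addr0 sqrtr_sqr.
by [].
Qed.

Lemma dist_energy_le e1 e2 : symmetric e1 -> symmetric e2 ->
  `|energy R e1 - energy R e2| <=
    \sum_u \sum_v `|(e1 u v)%:R - (e2 u v)%:R|.
Proof.
move=> s1 s2; rewrite ler_norml lerBlDl energy_le_add// andbT.
rewrite lerBrDr addrC lerBlDr.
apply: le_trans (energy_le_add s2 s1) _; rewrite lerD2l.
by apply: ler_sum => u _; apply: ler_sum => v _; rewrite distrC.
Qed.

End Energy.

(** * Riemann sums, and Hölder and Lipschitz estimates *)

Section RiemannSum.
Variable R : realType.
Local Notation mu := (@lebesgue_measure R).
Implicit Types (f g : R -> R) (K w : R).

Lemma holder_half_continuous f K :
  (forall x y, `|f x - f y| <= K * Num.sqrt `|x - y|) -> continuous f.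
Proof.
move=> fK x; apply/cvgrPdist_le => e e0.
have K0 : 0 < `|K| + 1 by rewrite ltr_pwDr.
near=> y; apply: le_trans (fK x y) _.
(* [K] may be zero or negative; [|K| + 1] is positive, so the radius (e / (|K| + 1))^2 makes sense
   and is positive. *)
apply: (@le_trans _ _ ((`|K| + 1) * Num.sqrt `|x - y|)).
  rewrite ler_wpM2r ?sqrtr_ge0// (le_trans (ler_norm _))// lerDl//.
rewrite -ler_pdivlMl// -[leRHS]ger0_norm; last first.
  by rewrite mulr_ge0 ?invr_ge0 ?ltW.
rewrite -[leRHS]sqrtr_sqr ler_wsqrtr//.
near: y; apply: cvgr_dist_le; first exact: cvg_id.
by rewrite exprn_gt0// mulr_gt0// invr_gt0.
Unshelve. all: by end_near. Qed.

Lemma continuous_itv_integrable f (a b : R) : continuous f ->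
  mu.-integrable `[a, b]%classic (EFin \o f).
Proof.
move=> cf; apply: continuous_compact_integrable; first exact: segment_compact.
exact: continuous_subspaceT.
Qed.

Lemma Rintegral_itv_cst (a b w : R) : a <= b ->
  \int[mu]_(x in `[a, b]) w = w * (b - a).
Proof.
move=> ab; rewrite Rintegral_cst; last exact: measurable_itv.
congr (_ * _); apply: etrans (congr1 fine (lebesgue_measure_itv `[a, b])) _.
rewrite /= lte_fin.
by case: ltgtP ab => //= -> _; rewrite subrr.
Qed.

Lemma dist_Rintegral_le f g a b w : a <= b ->
  continuous f -> continuous g ->
  (forall x, x \in `[a, b] -> `|f x - g x| <= w) ->
  `|\int[mu]_(x in `[a, b]) f x - \int[mu]_(x in `[a, b]) g x| <= w * (b - a).
Proof.
move=> ab cf cg fgw.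
have mab : measurable `[a, b]%classic by exact: measurable_itv.
have cfg : continuous (fun x => f x - g x).
  by move=> x; apply: continuousB; [exact: cf|exact: cg].
rewrite -RintegralB//; try exact: continuous_itv_integrable.
apply: le_trans (le_normr_Rintegral _ _) _ => //.
  exact: (continuous_itv_integrable a b cfg).
rewrite -Rintegral_itv_cst//.
apply: le_Rintegral => //.
- apply: (@continuous_itv_integrable (fun x => `|f x - g x|)) => x.
  by apply: cvg_norm; exact: cfg.
- by apply: continuous_itv_integrable => x; exact: cvg_cst.
Qed.

Lemma Rintegral_itv_split f (a b c : R) : a <= b -> b <= c -> continuous f ->
  \int[mu]_(x in `[a, c]) f x =
  \int[mu]_(x in `[a, b]) f x + \int[mu]_(x in `[b, c]) f x.
Proof.
move=> ab bc cf; apply/eqP; rewrite addrC -subr_eq; apply/eqP.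
rewrite Rintegral_itvB ?bnd_simp//; last exact: continuous_itv_integrable.
rewrite Rintegral_itv_obnd_cbnd//.
apply: integrableS (continuous_itv_integrable b c cf) => //.
by apply: subset_itvr; rewrite bnd_simp.
Qed.

(** Induction on [N]: the new cell of length [h] contributes an error of at most [w * h], since [f]
    stays within [w] of its value at the left endpoint. *)
Lemma riemann_sum_le f (h w : R) (N : nat) : 0 <= h -> continuous f ->
  (forall x y, `|x - y| <= h -> `|f x - f y| <= w) ->
  `|\sum_(i < N) f (i%:R * h) * h - \int[mu]_(x in `[0, N%:R * h]) f x|
    <= w * (N%:R * h).
Proof.
move=> h0 cf fw; elim: N => [|N IH].
  rewrite big_ord0 !mul0r mulr0 set_itv1 Rintegral_set1 subr0 normr0//.
rewrite big_ord_recr/= -natr1 mulrDl mul1r.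
rewrite (@Rintegral_itv_split _ 0 (N%:R * h)) ?lerDl ?mulr_ge0//.
rewrite opprD addrACA mulrDr (le_trans (ler_normD _ _))// lerD//.
have hE : N%:R * h + h - N%:R * h = h by rewrite addrAC subrr add0r.
have -> : f (N%:R * h) * h =
    \int[mu]_(x in `[N%:R * h, N%:R * h + h]) f (N%:R * h).
  by rewrite Rintegral_itv_cst ?hE// lerDl.
rewrite -[leRHS](congr1 ( *%R w) hE); apply: dist_Rintegral_le => //.
- by rewrite lerDl.
- by move=> x; exact: cvg_cst.
- move=> x; rewrite in_itv/= => /andP[x1 x2]; apply: fw.
  by rewrite distrC ger0_norm ?subr_ge0// lerBlDl.
Qed.

(** For b <= a, the square of sqrt b + sqrt (a - b) is a plus a nonnegative cross term. *)
Lemma dist_sqrt_le (a b : R) : 0 <= a -> 0 <= b ->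
  `|Num.sqrt a - Num.sqrt b| <= Num.sqrt `|a - b|.
Proof.
move=> a0 b0; wlog ba : a b a0 b0 / b <= a.
  move=> wl; have [|ab] := leP b a; first exact: wl.
  by rewrite distrC (distrC a); apply: wl => //; exact: ltW.
rewrite ger0_norm ?subr_ge0 ?ler_sqrt// ger0_norm ?subr_ge0//.
rewrite lerBlDr -[leRHS]ger0_norm ?addr_ge0// -[leRHS]sqrtr_sqr ler_wsqrtr//.
rewrite sqrrD !sqr_sqrtr ?subr_ge0// addrAC subrK lerDl.
by rewrite mulrn_wge0 ?mulr_ge0.
Qed.

Lemma dist_cos_le (x y : R) : `|cos x - cos y| <= `|x - y|.
Proof.
wlog yx : x y / y <= x.
  move=> wl; have [|xy] := leP y x; first exact: wl.
  by rewrite distrC (distrC x); apply: wl => //; exact: ltW.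
have [c _ ->] := @MVT_segment R (@cos R) (fun x => - sin x) y x yx
  (fun x _ => is_derive_cos x) (continuous_subspaceT (@continuous_cos R)).
by rewrite normrM normrN ler_piMl// sin_max.
Qed.

End RiemannSum.

(** * The symbol of the lattice and its double Riemann sum *)

Section HexSymbol.
Variable R : realType.
Local Notation mu := (@lebesgue_measure R).

Definition hex_symbol (x y : R) : R :=
  Num.sqrt (3 + 2 * cos x + 2 * cos y + 2 * cos (x + y)).

(** The right-hand side is the squared modulus of 1 + e^(ix) + e^(-iy), which also shows that the
    radicand is nonnegative. *)
Lemma hex_symbolE (x y : R) : 3 + 2 * cos x + 2 * cos y + 2 * cos (x + y) =
  (1 + cos x + cos y) ^+ 2 + (sin x - sin y) ^+ 2.
Proof. by rewrite cosD; have := cos2Dsin2 x; have := cos2Dsin2 y; lra. Qed.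

Lemma hex_symbolC x y : hex_symbol x y = hex_symbol y x.
Proof. by rewrite /hex_symbol (addrC x y); congr Num.sqrt; ring. Qed.

(** Two cosine terms with coefficient 2 depend on x, so the radicand is 4-Lipschitz in x; the
    constant 2 is the square root of 4. *)
Lemma hex_symbol_holder x x' y :
  `|hex_symbol x y - hex_symbol x' y| <= 2 * Num.sqrt `|x - x'|.
Proof.
apply: le_trans (dist_sqrt_le _ _) _.
- by rewrite hex_symbolE addr_ge0 ?sqr_ge0.
- by rewrite hex_symbolE addr_ge0 ?sqr_ge0.
rewrite -[X in _ <= X * _](@ger0_norm _ 2)// -[X in _ <= X * _]sqrtr_sqr.
rewrite -sqrtrM ?sqr_ge0// ler_wsqrtr//.

have c1 := dist_cos_le x x'; have := dist_cos_le (x + y) (x' + y).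
rewrite opprD addrACA subrr addr0 => c2.
rewrite (_ : _ - _ = 2 * (cos x - cos x') + 2 * (cos (x + y) - cos (x' + y)));
  last by ring.
apply: le_trans (ler_normD _ _) _; rewrite !normrM !(@ger0_norm _ 2)//.
lra.
Qed.

Lemma hex_symbol_continuous y : continuous (hex_symbol^~ y).
Proof.
apply: (@holder_half_continuous _ _ 2) => x x'; exact: hex_symbol_holder.
Qed.

(** The sum over x is compared with the inner integral [J y] for each fixed y, then the sum of [J]
    with the outer integral. By the symmetry of the symbol, [J] is again 1/2-Hölder, with an extra
    factor [T] from integrating over x. *)
Lemma hex_riemann_sum (N M : nat) :
  `|(N.+1%:R * M.+1%:R)^-1 * (\sum_(b < M.+1) \sum_(a < N.+1)
      hex_symbol (a%:R * (2 * pi / N.+1%:R)) (b%:R * (2 * pi / M.+1%:R))) -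
    (4 * pi ^+ 2)^-1 * \int[mu]_(y in `[0, 2 * pi])
       \int[mu]_(x in `[0, 2 * pi]) hex_symbol x y|
  <= 2 * (Num.sqrt (2 * pi / N.+1%:R) + Num.sqrt (2 * pi / M.+1%:R)).
Proof.
set T : R := 2 * pi; set h := T / N.+1%:R; set k := T / M.+1%:R.
set J := fun y => \int[mu]_(x in `[0, T]) hex_symbol x y.
have T0 : 0 < T by rewrite mulr_gt0 ?pi_gt0.
have h0 : 0 < h by rewrite divr_gt0.
have k0 : 0 < k by rewrite divr_gt0.
have Nh : N.+1%:R * h = T by rewrite mulrC divfK.
have Mk : M.+1%:R * k = T by rewrite mulrC divfK.
have inner y : `|\sum_(a < N.+1) hex_symbol (a%:R * h) y * h - J y| <=
    2 * Num.sqrt h * T.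
  have := @riemann_sum_le _ (hex_symbol^~ y) h (2 * Num.sqrt h) N.+1 (ltW h0)
    (@hex_symbol_continuous y).
  rewrite Nh; apply => x x' xx'; apply: le_trans (hex_symbol_holder _ _ _) _.
  by rewrite ler_pM2l// ler_wsqrtr.
have Jh y y' : `|J y - J y'| <= 2 * T * Num.sqrt `|y - y'|.
  rewrite mulrAC -[X in _ * X](subr0 T); apply: dist_Rintegral_le.
  - exact: ltW.
  - exact: hex_symbol_continuous.
  - exact: hex_symbol_continuous.
  by move=> x _; rewrite !(hex_symbolC x) hex_symbol_holder.
have outer : `|\sum_(b < M.+1) J (b%:R * k) * k -
    \int[mu]_(y in `[0, T]) J y| <= 2 * T * Num.sqrt k * T.
  have := @riemann_sum_le _ J k (2 * T * Num.sqrt k) M.+1 (ltW k0)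
    (holder_half_continuous Jh).
  rewrite Mk; apply => y y' yy'; apply: le_trans (Jh _ _) _.
  by rewrite ler_wpM2l ?ler_wsqrtr// mulr_ge0 ?ltW.
set S := \sum_(b < M.+1) _; set I := \int[mu]_(y in _) _.
have -> : (4 * pi ^+ 2 : R) = T ^+ 2 by rewrite /T; ring.
have -> : (N.+1%:R * M.+1%:R)^-1 = (T ^+ 2)^-1 * (h * k) :> R.
  by rewrite /h /k; field; rewrite ?gt_eqF// !pnatr_eq0.
rewrite -mulrA -mulrBr normrM ger0_norm ?invr_ge0 ?sqr_ge0//.
rewrite ler_pdivrMl ?exprn_gt0//.
have -> : h * k * S - I =
   \sum_(b < M.+1) (\sum_(a < N.+1) hex_symbol (a%:R * h) (b%:R * k) * h
       - J (b%:R * k)) * k + (\sum_(b < M.+1) J (b%:R * k) * k - I).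
  rewrite addrA; congr (_ - _); rewrite -big_split/= /S mulr_sumr.
  apply: eq_bigr => b _; rewrite -mulr_suml mulrBl subrK; ring.
apply: le_trans (ler_normD _ _) _.
have -> : T ^+ 2 * (2 * (Num.sqrt h + Num.sqrt k)) =
  \sum_(b < M.+1) (2 * Num.sqrt h * T * k) + 2 * T * Num.sqrt k * T.
  by rewrite sumr_const card_ord -[X in _ = X + _]mulr_natl
    [X in _ = X + _]mulrCA Mk; ring.
apply: lerD => //; apply: le_trans (ler_norm_sum _ _ _) _.
by apply: ler_sum => b _; rewrite normrM (gtr0_norm k0) ler_pM2r.
Qed.

End HexSymbol.

(** * Characters of finite cyclic groups *)

Section Characters.
Variable R : realType.
Local Notation C := R[i].

Definition cis (x : R) : C := (cos x +i* sin x)%C.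

Lemma cisD x y : cis (x + y) = cis x * cis y.
Proof. by rewrite /cis cosD sinD [X in (_ +i* X)%C]addrC. Qed.

Lemma cis0 : cis 0 = 1.
Proof. by rewrite /cis cos0 sin0. Qed.

Lemma cisX x k : cis x ^+ k = cis (k%:R * x).
Proof.
elim: k => [|k IH]; first by rewrite expr0 mul0r cis0.
by rewrite exprS IH -cisD -natr1 mulrDl mul1r addrC.
Qed.

Lemma conj_cis x : (cis x)^* = cis (- x).
Proof. by rewrite /cis cosN sinN. Qed.

Lemma cis_neq0 x : cis x != 0.
Proof.
apply/eqP => /(congr1 ( *%R (cis (- x)))).
by rewrite mulr0 -cisD addNr cis0 => /eqP; rewrite oner_eq0.
Qed.

Lemma cisV x : (cis x)^-1 = cis (- x).
Proof.
by apply: (mulfI (cis_neq0 x)); rewrite -cisD subrr cis0 divff// cis_neq0.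
Qed.

Lemma cis_root N (a : nat) : cis (a%:R * (2 * pi / N.+1%:R)) ^+ N.+1 = 1.
Proof.
rewrite cisX mulrCA (_ : N.+1%:R * _ = pi *+ 2); last first.
  by rewrite mulrC divfK ?pnatr_eq0// mulr_natl.
by rewrite -cisX /cis cos2pi sin2pi expr1n.
Qed.

(** If x is nonzero, |x| / 2 lies strictly between 0 and pi, where the sine is positive; but cos x =
    1 forces sin (|x| / 2) = 0. *)
Lemma cis_eq1 x : `|x| < 2 * pi -> cis x = 1 -> x = 0.
Proof.
move=> x2 -[cx _]; apply/eqP; rewrite -normr_eq0; apply: contraT => x0.
have : 0 < sin (`|x| / 2).
  have x_gt0 : 0 < `|x| by rewrite lt_def x0 /=.
  by apply: sin_gt0_pi; apply/andP; split; lra.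
have : cos (`|x| / 2 *+ 2) = 1 by rewrite -mulr_natr divfK// cos_norm.
rewrite cos_mulr2n cos2sin2 => e.
suff : sin (`|x| / 2) ^+ 2 = 0.
  by move/eqP; rewrite sqrf_eq0 => /eqP ->; rewrite ltxx.
lra.
Qed.

(** Geometric sum in an (N+1)-th root of unity, which differs from 1 unless a = b because the angles
    differ by less than 2 pi. The sign [s] covers both e^(ix) and e^(-iy). *)
Lemma cis_orthogonal N (a b : nat) (s : bool) : (a < N.+1)%N -> (b < N.+1)%N ->
  let e := fun k : nat => cis ((-1) ^+ s * (k%:R * (2 * pi / N.+1%:R))) in
  \sum_(i < N.+1) (e a ^+ i)^* * e b ^+ i = (N.+1 * (a == b))%:R.
Proof.
move=> aN bN e.
have -> : \sum_(i < N.+1) (e a ^+ i)^* * e b ^+ i =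
          \sum_(i < N.+1) ((e a)^* * e b) ^+ i.
  by apply: eq_bigr => i _; rewrite rmorphXn exprMn.
have [<-|ab] := eqVneq a b.
  rewrite muln1 conj_cis -cisD addNr cis0.
  by under eq_bigr do rewrite expr1n; rewrite sumr_const card_ord.
rewrite muln0; apply/eqP; set q := (e a)^* * e b.
have root k : e k ^+ N.+1 = 1.
  rewrite /e; case: s {e q} => /=; last by rewrite mul1r cis_root.
  by rewrite mulN1r -conj_cis -rmorphXn cis_root rmorph1.
have qN : q ^+ N.+1 = 1 by rewrite /q exprMn -rmorphXn !root rmorph1 mulr1.
have : (q - 1) * \sum_(i < N.+1) q ^+ i == 0 by rewrite -subrX1 qN subrr.
rewrite mulf_eq0 subr_eq0 => /orP[/eqP|//].
rewrite /q conj_cis -cisD -mulrN -mulrDr addrC -mulrBl => q1.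
exfalso; move: q1; set h := 2 * pi / _.
have h0 : 0 < h by rewrite divr_gt0 ?mulr_gt0 ?pi_gt0.
move=> /cis_eq1 q1; have : (-1) ^+ s * ((b%:R - a%:R) * h) = 0.
  apply: q1; rewrite normrM normrX normrN1 expr1n mul1r normrM (gtr0_norm h0).
  rewrite -ltr_pdivlMr//.
  have -> : 2 * pi / h = N.+1%:R.
    by rewrite /h invf_div mulrC divfK// gt_eqF// mulr_gt0 ?pi_gt0.
  have aN' : (a%:R : R) < N.+1%:R by rewrite ltr_nat.
  have bN' : (b%:R : R) < N.+1%:R by rewrite ltr_nat.
  have a0 : (0 : R) <= a%:R by []. have b0 : (0 : R) <= b%:R by [].
  by rewrite ltr_norml; apply/andP; split; lra.
move/eqP; rewrite mulf_eq0 signr_eq0 /= mulf_eq0 (gt_eqF h0) orbF subr_eq0 eqr_nat.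
by rewrite eq_sym (negbTE ab).
Qed.

End Characters.

(** * Neighbourhoods in the toroidal lattice *)

Section TorusNeighbours.
Variables n m : nat.
Hypotheses (n_gt0 : (0 < n)%N) (m_gt0 : (0 < m)%N).
Local Notation hexV := (hexV n m).
Implicit Types u v : hexV.

(** Case form of cyclic succession, which leaves linear goals once the tests are split. *)
Lemma modn_succ K i : (i < K)%N ->
  (i.+1 %% K)%N = if i.+1 == K then 0%N else i.+1.
Proof.
by move=> iK; case: eqP => [->|/eqP iK']; rewrite ?modnn// modn_small; lia.
Qed.

Lemma modn_pred K i : (i < K)%N ->
  ((i + K.-1) %% K)%N = if i == 0%N then K.-1 else i.-1.
Proof.
move=> iK; case: eqP => [->|/eqP i0]; first by rewrite add0n modn_small; lia.
have -> : (i + K.-1 = i.-1 + K)%N by lia.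
by rewrite modnDr modn_small; lia.
Qed.

Lemma hor_rungE (x y : nat) : (x < 2 * m.+1)%N ->
  [exists k : 'I_m.+1, (x == 2 * k + 1)%N && (y == 2 * k)%N] =
  odd x && (x == y.+1).
Proof.
move=> xm; apply/existsP/andP => [[k /andP[/eqP -> /eqP ->]]|[ox /eqP xy]].
  by rewrite !addn1 /= mul2n odd_double.
have hm : (y./2 < m.+1)%N by lia.
by exists (Ordinal hm) => /=; lia.
Qed.

Lemma hex_torusE u v : hex_torus u v =
  [|| (v.1 == u.1) && (v.2 == u.2.+1 %% (2 * m.+1) :> nat)%N,
      (u.1 == v.1) && (u.2 == v.2.+1 %% (2 * m.+1) :> nat)%N,
      (v.1 == u.1.+1 %% n.+1 :> nat)%N && (odd u.2 && (u.2 == v.2.+1 :> nat)) |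
      (u.1 == v.1.+1 %% n.+1 :> nat)%N && (odd v.2 && (v.2 == u.2.+1 :> nat))].
Proof.
rewrite /hex_torus /symclosure /vert_arc /hor_arc !hor_rungE//.
by rewrite !orbA.
Qed.

Lemma hex_torus_sym : symmetric (@hex_torus n m).
Proof.
move=> u v; rewrite /hex_torus /symclosure.
by rewrite (orbC (vert_arc u v)) (orbC (hor_arc u v)).
Qed.

Lemma mul2_pos : (0 < 2 * m.+1)%N. Proof. by []. Qed.

(** Reducing both coordinates makes this total on naturals, so neighbours can be named without bound
    proofs. *)
Definition hexv (i j : nat) : hexV :=
  (Ordinal (ltn_pmod i (ltn0Sn n)), Ordinal (ltn_pmod j mul2_pos)).

Lemma hexv_eq (u : hexV) i j : (i < n.+1)%N -> (j < 2 * m.+1)%N ->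
  (u == hexv i j) = (u.1 == i :> nat) && (u.2 == j :> nat).
Proof. by move=> iN jM; rewrite -pair_eqE /= -!val_eqE /= !modn_small. Qed.

Lemma hex_torus_odd v k : v.2 = (2 * k + 1)%N :> nat -> hex_torus v =1
  mem [:: hexv v.1 (2 * k); hexv v.1 (2 * (k.+1 %% m.+1));
          hexv (v.1.+1 %% n.+1) (2 * k)].
Proof.
move=> vk u /=; have v1 := ltn_ord v.1; have v2 := ltn_ord v.2.
have u1 := ltn_ord u.1; have u2 := ltn_ord u.2.
have kM : (2 * k < 2 * m.+1)%N by lia.
have kM' : (k < m.+1)%N by lia.
have kM1 : (2 * (k.+1 %% m.+1) < 2 * m.+1)%N by rewrite ltn_pmul2l// ltn_pmod.
rewrite hex_torusE !inE !hexv_eq ?ltn_pmod// -!val_eqE /= !modn_succ// {kM1}.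
move: vk v1 v2 u1 u2.
case: u v => [[i ?] [j ?]] [[i' ?] [j' ?]] /= vk v1 v2 u1 u2; subst j'.
apply/idP/idP.
  move=> /or4P[] /andP[/eqP e1]; [move/eqP => e2|move/eqP => e2|
    move=> /andP[jo /eqP e2]|move=> /andP[jo /eqP e2]];
    move: e1 e2; do !(case: ifP => ?); lia.
move=> /or3P[] /andP[/eqP e1 /eqP e2].
- move: e1 e2; do !(case: ifP => ?); lia.
- move: e1 e2; do !(case: ifP => ?); lia.
- move: e1 e2; do !(case: ifP => ?); lia.
Qed.

(** Cyclic predecessors are written as additions of [m] and [n] modulo [m.+1] and [n.+1], which
    avoids truncated subtraction and suits powers of roots of unity. *)
Lemma hex_torus_even v k : v.2 = (2 * k)%N :> nat -> hex_torus v =1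
  mem [:: hexv v.1 (2 * k + 1); hexv v.1 (2 * ((k + m) %% m.+1) + 1);
          hexv ((v.1 + n) %% n.+1) (2 * k + 1)].
Proof.
move=> vk u /=; have v1 := ltn_ord v.1; have v2 := ltn_ord v.2.
have u1 := ltn_ord u.1; have u2 := ltn_ord u.2.
have kM : (k < m.+1)%N by lia.
have kM0 : (2 * k + 1 < 2 * m.+1)%N by lia.
have kM1 : (2 * ((k + m) %% m.+1) + 1 < 2 * m.+1)%N.
  by have := ltn_pmod (k + m) (ltn0Sn m); lia.
rewrite hex_torusE !inE !hexv_eq ?ltn_pmod// -!val_eqE /= !modn_succ// {kM1}.
rewrite (@modn_pred n.+1)// (@modn_pred m.+1)//.
move: vk v1 v2 u1 u2.
case: u v => [[i ?] [j ?]] [[i' ?] [j' ?]] /= vk v1 v2 u1 u2; subst j'.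
apply/idP/idP.
  move=> /or4P[] /andP[/eqP e1]; [move/eqP => e2|move/eqP => e2|
    move=> /andP[jo /eqP e2]|move=> /andP[jo /eqP e2]];
    move: e1 e2; do !(case: ifP => ?); lia.
move=> /or3P[] /andP[/eqP e1 /eqP e2].
- move: e1 e2; do !(case: ifP => ?); lia.
- move: e1 e2; do !(case: ifP => ?); lia.
- move: e1 e2; do !(case: ifP => ?); lia.
Qed.

Lemma uniq_hexv3 i1 j1 i2 j2 i3 j3 :
  (i1 < n.+1)%N -> (i2 < n.+1)%N -> (i3 < n.+1)%N ->
  (j1 < 2 * m.+1)%N -> (j2 < 2 * m.+1)%N -> (j3 < 2 * m.+1)%N ->
  (i1, j1) != (i2, j2) -> (i1, j1) != (i3, j3) -> (i2, j2) != (i3, j3) ->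
  uniq [:: hexv i1 j1; hexv i2 j2; hexv i3 j3].
Proof.
move=> ? ? ? ? ? ?; rewrite /= !inE !hexv_eq//= !modn_small//.
rewrite -!pair_eqE /=; lia.
Qed.

(** Positivity of [n] and [m] makes the three neighbours distinct, so each contributes its own
    term. *)
Lemma hex_torus_sum (K : pzRingType) (p : nat -> nat -> K) v :
  \sum_u (hex_torus v u)%:R * p u.1 u.2 =
  let i : nat := v.1 in let k := (v.2)./2 in
  if odd v.2 then
    p i (2 * k)%N + p i (2 * (k.+1 %% m.+1))%N + p (i.+1 %% n.+1)%N (2 * k)%N
  else
    p i (2 * k + 1)%N + p i (2 * ((k + m) %% m.+1) + 1)%N
    + p ((i + n) %% n.+1)%N (2 * k + 1)%N.
Proof.
move=> /=; have v1 := ltn_ord v.1; have v2 := ltn_ord v.2.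
have sumE (s : seq hexV) : hex_torus v =1 mem s -> uniq s ->
    \sum_u (hex_torus v u)%:R * p u.1 u.2 = \sum_(u <- s) p u.1 u.2.
  move=> hs us; rewrite (big_uniq _ us) [RHS]big_mkcond; apply: eq_bigr => u _.
  by rewrite hs /=; case: ifP; rewrite ?mul1r ?mul0r.
case: ifP => ov.
  have vk : v.2 = (2 * v.2./2 + 1)%N :> nat by lia.
  rewrite (sumE _ (hex_torus_odd vk)).
    rewrite !big_cons big_nil /= addr0 !(modn_small v1) modn_mod.
    rewrite (@modn_small (2 * v.2./2)); last by lia.
    rewrite (@modn_small (2 * _)) ?addrA//.
    by have := ltn_pmod v.2./2.+1 (ltn0Sn m); lia.
  rewrite !modn_succ//; last by lia.
  move: v1 v2 vk ov {sumE}; move: (nat_of_ord v.1) (nat_of_ord v.2) => i j.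
  by move=> *; apply: uniq_hexv3; rewrite -?pair_eqE /=; do ?[case: ifP => ?]; lia.
have vk : v.2 = (2 * v.2./2)%N :> nat by lia.
rewrite (sumE _ (hex_torus_even vk)).
  rewrite !big_cons big_nil /= addr0 !(modn_small v1) modn_mod.
  rewrite (@modn_small (2 * v.2./2 + 1)); last by lia.
  rewrite (@modn_small (2 * _ + 1)) ?addrA//.
  by have := ltn_pmod (v.2./2 + m) (ltn0Sn m); lia.
rewrite (@modn_pred n.+1)// (@modn_pred m.+1); last by lia.
move: v1 v2 vk ov {sumE}; move: (nat_of_ord v.1) (nat_of_ord v.2) => i j.
  by move=> *; apply: uniq_hexv3; rewrite -?pair_eqE /=; do ?[case: ifP => ?]; lia.
Qed.

End TorusNeighbours.

(** * Diagonalisation of the torus *)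

Section TorusEnergy.
Variables (R : realType) (n m : nat).
Hypotheses (n_gt0 : (0 < n)%N) (m_gt0 : (0 < m)%N).
Local Notation C := R[i].
Local Notation hexV := (hexV n m).
Implicit Types u v : hexV.
Local Open Scope sesquilinear_scope.

Lemma sum_double (V : nmodType) K (F : nat -> V) :
  \sum_(j < 2 * K) F j = \sum_(k < K) (F (2 * k)%N + F (2 * k + 1)%N).
Proof.
elim: K => [|K IH]; first by rewrite muln0 !big_ord0.
by rewrite mulnS addnC !addn2 !big_ord_recr /= IH addn1 -addrA.
Qed.

Lemma sum_hexV (V : nmodType) (F : nat -> nat -> V) :
  \sum_(u : hexV) F u.1 u.2 =
  \sum_(i < n.+1) \sum_(k < m.+1) (F i (2 * k)%N + F i (2 * k + 1)%N).
Proof.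
rewrite -(pair_bigA _ (fun (i : 'I_n.+1) (j : 'I_(2 * m.+1)) => F i j))/=.
by apply: eq_bigr => i _; rewrite (sum_double _ (F i)).
Qed.

Let X v : R := (v.1 : nat)%:R * (2 * pi / n.+1%:R).
Let Y v : R := ((v.2)./2)%:R * (2 * pi / m.+1%:R).
Let sgn v : R := (-1) ^+ odd v.2.

(** On waves of a given momentum the adjacency operator is a 2 x 2 block, indexed by the parity of
    the second coordinate, with zero diagonal and this factor and its conjugate off the diagonal. *)
Definition hex_factor (x y : R) : C := 1 + cis x + cis (- y).

Lemma normr_hex_factor x y : `|hex_factor x y| = (hex_symbol x y)%:C%C.
Proof.
rewrite normc_def /hex_factor /hex_symbol hex_symbolE /= cosN sinN.
by rewrite add0r.
Qed.

Lemma conj_hex_factor x y :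
  (hex_factor x y)^* = 1 + (cis x)^-1 + (cis (- y))^-1.
Proof. by rewrite /hex_factor !rmorphD rmorph1 !cisV -!conj_cis. Qed.

(** The default 1 keeps the phase of modulus 1 where the factor vanishes, so the two waves at that
    momentum stay orthogonal. *)
Definition hex_phase (x y : R) : C :=
  if hex_factor x y == 0 then 1 else hex_factor x y / `|hex_factor x y|.

Lemma norm_hex_phase x y : (hex_phase x y)^* * hex_phase x y = 1.
Proof.
rewrite mulrC -normCK /hex_phase; case: eqP => [_|/eqP f0].
  by rewrite normr1 expr1n.
by rewrite normrM normfV normr_id divff ?expr1n// normr_eq0.
Qed.

Lemma hex_phaseM x y : `|hex_factor x y| * hex_phase x y = hex_factor x y.
Proof.
rewrite /hex_phase; case: eqP => [->|/eqP f0]; first by rewrite normr0 mul0r.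
by rewrite mulrC divfK// normr_eq0.
Qed.

Lemma hex_phase_conj x y :
  hex_phase x y * (hex_factor x y)^* = `|hex_factor x y|.
Proof.
rewrite -{1}hex_phaseM rmorphM mulrCA [_ * (hex_phase _ _)^*]mulrC.
by rewrite norm_hex_phase mulr1; exact: (conj_Creal (normr_real _)).
Qed.

(* The set [hexV] also labels the eigenvectors: [v] stands for the momentum
   (X v, - Y v), and the parity of [v.2] selects the sign of the eigenvalue. *)
Definition hex_wave v (i j : nat) : C :=
  cis (X v) ^+ i * cis (- Y v) ^+ j./2 *
  (if odd j then (sgn v)%:C%C * hex_phase (X v) (Y v) else 1).

Lemma cisX_root v : cis (X v) ^+ n.+1 = 1.
Proof. exact: cis_root. Qed.

Lemma cisY_root v : cis (- Y v) ^+ m.+1 = 1.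
Proof. by rewrite -conj_cis -rmorphXn cis_root rmorph1. Qed.

Lemma expr_pred_root (z : C) K k : z ^+ K.+1 = 1 -> z != 0 ->
  z ^+ (k + K) = z ^+ k * z^-1.
Proof.
by move=> zK z0; apply: (mulIf z0); rewrite mulfVK// -exprSr -addnS exprD zK mulr1.
Qed.

Lemma sgn2 v : (sgn v)%:C%C * (sgn v)%:C%C = 1 :> C.
Proof. by rewrite -rmorphM -expr2 sqrr_sign rmorph1. Qed.

Lemma hex_wave_eigen v (w : hexV) :
  \sum_u (@hex_torus n m w u)%:R * hex_wave v u.1 u.2 =
  hex_wave v w.1 w.2 * (sgn v * hex_symbol (X v) (Y v))%:C%C.
Proof.
rewrite (hex_torus_sum n_gt0 m_gt0 (hex_wave v)) [X in _ = _ * X]rmorphM /=.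
rewrite -normr_hex_factor /hex_wave.
have h1 k : (2 * k + 1)./2 = k by lia.
have h0 k : (2 * k)./2 = k by lia.
have o1 k : odd (2 * k + 1) by lia.
have o0 k : odd (2 * k) = false by lia.
case: ifP => ow; rewrite !(h1, h0, o1, o0) !expr_mod ?cisX_root ?cisY_root//.
  rewrite !exprS; set z := cis (X v) ^+ w.1; set y := cis (- Y v) ^+ _.
  transitivity (z * y * hex_factor (X v) (Y v)).
    by rewrite /hex_factor; ring.
  rewrite -{1}hex_phaseM; set p := hex_phase _ _; set s := (sgn v)%:C%C.
  (* The wave at an odd site already carries one sign and the eigenvalue a second one; their product
     is 1. *)
  rewrite -[LHS]mul1r -(sgn2 v) -/s; ring.
rewrite !expr_pred_root ?cisX_root ?cisY_root ?cis_neq0//.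
set z := cis (X v) ^+ w.1; set y := cis (- Y v) ^+ _.
rewrite -hex_phase_conj conj_hex_factor.
by set p := hex_phase _ _; set s := (sgn v)%:C%C; ring.
Qed.

(** Summing over unit cells factors the inner product into two character sums, which vanish unless
    the momenta agree, and a factor 1 + s s', which is 2 or 0 according to the signs. *)
Lemma hex_wave_orthogonal v v' :
  \sum_(u : hexV) (hex_wave v u.1 u.2)^* * hex_wave v' u.1 u.2 =
  (2 * n.+1 * m.+1 * (v == v'))%:R.
Proof.
rewrite (sum_hexV (fun i j => (hex_wave v i j)^* * hex_wave v' i j)).
set c := fun v => (sgn v)%:C%C * hex_phase (X v) (Y v).
have -> : \sum_(i < n.+1) \sum_(k < m.+1)
    ((hex_wave v i (2 * k))^* * hex_wave v' i (2 * k) +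
     (hex_wave v i (2 * k + 1))^* * hex_wave v' i (2 * k + 1)) =
  (\sum_(i < n.+1) (cis (X v) ^+ i)^* * cis (X v') ^+ i) *
  (\sum_(k < m.+1) (cis (- Y v) ^+ k)^* * cis (- Y v') ^+ k) *
  (1 + (c v)^* * c v').
  rewrite -mulrA mulr_suml; apply: eq_bigr => i _.
  rewrite mulr_suml mulr_sumr; apply: eq_bigr => k _.
  have h1 : (2 * k + 1)./2 = k by lia.
  have h0 : (2 * k)./2 = k by lia.
  have o1 : odd (2 * k + 1) by lia.
  have o0 : odd (2 * k) = false by lia.
  have conj3 (a b d a' b' d' : C) : (a * b * d)^* * (a' * b' * d') =
      a^* * a' * (b^* * b') * (d^* * d') by rewrite !rmorphM /=; ring.
  have J1 : (1 : C)^* = 1 by exact: rmorph1.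
  by rewrite /hex_wave h0 h1 o0 o1 !conj3 J1 mulr1 -mulrDr -mulrA.
have /= EX := @cis_orthogonal R n v.1 v'.1 false (ltn_ord _) (ltn_ord _).
have k_lt (w : hexV) : ((w.2)./2 < m.+1)%N by have := ltn_ord w.2; lia.
have /= EY := @cis_orthogonal R m _ _ true (k_lt v) (k_lt v').
rewrite expr0 expr1 in EX EY.
have -> : \sum_(i < n.+1) (cis (X v) ^+ i)^* * cis (X v') ^+ i =
    (n.+1 * (v.1 == v'.1 :> nat))%:R.
  by rewrite -EX; apply: eq_bigr => i _; rewrite !mul1r.
have -> : \sum_(k < m.+1) (cis (- Y v) ^+ k)^* * cis (- Y v') ^+ k =
    (m.+1 * (v.2./2 == v'.2./2))%:R.
  by rewrite -EY; apply: eq_bigr => i _; rewrite !mulN1r.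
have vE : (v == v') = [&& v.1 == v'.1 :> nat, v.2./2 == v'.2./2 &
    odd v.2 == odd v'.2].
  rewrite -pair_eqE /= -!val_eqE /=; congr andb.
  by apply/eqP/andP => [->|[/eqP h /eqP o]]; [rewrite !eqxx|lia].
rewrite vE; case: eqP => [e1|_]; last by rewrite !(muln0, mul0r).
case: eqP => [e2|_]; last by rewrite !(muln0, mulr0, mul0r).
have -> : (c v)^* * c v' = (sgn v * sgn v')%:C%C.
  have eX : X v = X v' by rewrite /X e1.
  have eY : Y v = Y v' by rewrite /Y e2.
  rewrite /c eX eY rmorphM mulrACA norm_hex_phase mulr1 rmorphM.
  by congr (_ * _); exact: conjc_real.
rewrite /sgn; case: (odd v.2); case: (odd v'.2) => /=;
  rewrite ?(expr1, expr0, mulrN1, mulN1r, opprK, mulr1, muln1, muln0).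
all: rewrite ?(rmorphN, rmorph1) ?subrr ?mulr0//; rewrite !natrM; ring.
Qed.

Lemma energy_torus :
  energy R (@hex_torus n m) =
  2 * \sum_(b < m.+1) \sum_(a < n.+1)
    hex_symbol (a%:R * (2 * pi / n.+1%:R)) (b%:R * (2 * pi / m.+1%:R)).
Proof.
(* The common squared norm of the waves, equal to the number of vertices. *)
set K : C := (2 * n.+1 * m.+1)%:R.
pose P : 'M[C]_#|hexV| := \matrix_(i, j)
  hex_wave (enum_val j) (enum_val i : hexV).1 (enum_val i : hexV).2.
have reenum (F : hexV -> C) : \sum_(i < #|hexV|) F (enum_val i) = \sum_u F u.
  by rewrite [RHS](reindex (@enum_val hexV predT))//; exact/onW_bij/enum_val_bij.
have K0 : K != 0 by rewrite pnatr_eq0.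
have PP : P^t* *m P = K%:M.
  apply/matrixP => i j; rewrite !mxE.
  rewrite -[_ *+ (i == j)]mulr_natr -natrM -(inj_eq enum_val_inj).
  rewrite -hex_wave_orthogonal -reenum.
  by apply: eq_bigr => k _; rewrite !mxE.
have Pu : P \in unitmx.
  suff /mulmx1_unit[] : (K^-1 *: P^t*) *m P = 1%:M by [].
  by rewrite -scalemxAl PP scale_scalar_mx mulVf.
rewrite (energy_diag (d := fun i => sgn (enum_val i) *
    hex_symbol (X (enum_val i)) (Y (enum_val i))) Pu); last first.
  apply/matrixP => i j; rewrite mul_mx_diag !mxE -hex_wave_eigen -reenum.
  by apply: eq_bigr => k _; rewrite !mxE rmorph_nat.
transitivity (\sum_(u : hexV) hex_symbol (X u) (Y u)).
  rewrite [RHS](reindex (@enum_val hexV predT))/=; last exact/onW_bij/enum_val_bij.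
  apply: eq_bigr => i _; rewrite normrM normr_sign mul1r ger0_norm//.
  exact: sqrtr_ge0.
(* Labels 2k and 2k + 1 carry opposite eigenvalues of equal modulus, whence the factor 2. *)
rewrite (sum_hexV (fun i j => hex_symbol (i%:R * (2 * pi / n.+1%:R))
   (j./2%:R * (2 * pi / m.+1%:R)))) exchange_big mulr_sumr/=.
apply: eq_bigr => k _; rewrite mulr_sumr; apply: eq_bigr => i _.
have -> : (2 * k + 1)./2 = k by lia.
have -> : (2 * k)./2 = k by lia.
by rewrite [RHS]mulr_natl [RHS]mulr2n.
Qed.

End TorusEnergy.

(** * Effect of edge deletion on the energy *)

Section EdgeDeletion.
Variables (R : realType) (T : finType).
Implicit Types (e a : rel T).

(** [hex_cylinder] and [hex_free] are instances of this by unfolding. *)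
Definition delete_edges e a : rel T := fun u v => e u v && ~~ symclosure a u v.

Lemma delete_edges_sym e a : symmetric e -> symmetric (delete_edges e a).
Proof. by move=> se u v; rewrite /delete_edges /symclosure se orbC. Qed.

Lemma dist_energy_delete_edges e a : symmetric e ->
  `|energy R (delete_edges e a) - energy R e| <=
    2 * \sum_u \sum_v (a u v)%:R.
Proof.
move=> se; apply: le_trans (dist_energy_le _ (delete_edges_sym a se) se) _.
rewrite mulr_natl mulr2n [X in _ <= _ + X]exchange_big -big_split/=.
apply: ler_sum => u _; rewrite -big_split/=; apply: ler_sum => v _; rewrite /delete_edges /symclosure.
rewrite -natrD.
by case: (e u v); case: (a u v); case: (a v u) => //=;
  rewrite ?(subr0, sub0r, subrr, normrN, normr0, normr1) ?ler1n ?ler0n.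
Qed.

(** The hypothesis makes [f] of the source an injective labelling of the arcs by [K] labels. *)
Lemma sum_matching_le K a (f : T -> 'I_K) :
  (forall u v u' v', a u v -> a u' v' -> f u = f u' -> u = u' /\ v = v') ->
  \sum_u \sum_v (a u v)%:R <= K%:R :> R.
Proof.
move=> af; rewrite pair_bigA/=.
pose A := [pred p : T * T | a p.1 p.2].
have -> : \sum_(p : T * T) (a p.1 p.2)%:R = #|A|%:R :> R.
  rewrite -sum1_card natr_sum [RHS]big_mkcond/=; apply: eq_bigr => p _.
  by rewrite inE /=; case: (a _ _).
have := max_card (mem [seq f p.1 | p in A]).
rewrite card_ord card_in_image ?ler_nat// => -[u v] [u' v'].
rewrite !inE /= => auv auv' fu.
by have [-> ->] := af _ _ _ _ auv auv' fu.
Qed.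

End EdgeDeletion.

(** * Counting the wrapping edges *)

Section HexBoundary.
Variables (R : realType) (n m : nat).

Lemma vert_wrap_count :
  \sum_u \sum_v (@vert_wrap_arc n m u v)%:R <= n.+1%:R :> R.
Proof.
apply: (@sum_matching_le _ _ _ _ (fun u : hexV n m => u.1)).
move=> [i j] [i' j'] [k l] [k' l']; rewrite /vert_wrap_arc /=.
move=> /andP[/andP[/eqP -> /eqP ej] /eqP ej'].
move=> /andP[/andP[/eqP -> /eqP el] /eqP el'] ->.
by split; congr pair; apply: val_inj => /=; congruence.
Qed.

Lemma hor_wrap_count :
  \sum_u \sum_v (@hor_wrap_arc n m u v)%:R <= m.+1%:R :> R.
Proof.
(* The label is the index k of the arc, recovered from its source height 2k + 1. *)
apply: (@sum_matching_le _ _ _ _ (fun u : hexV n m => inord (u.2)./2)).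
move=> [i j] [i' j'] [k l] [k' l']; rewrite /hor_wrap_arc /=.
move=> /andP[/andP[/eqP ei /eqP ei'] /existsP[x /andP[/eqP jx /eqP jx']]].
move=> /andP[/andP[/eqP ek /eqP ek'] /existsP[y /andP[/eqP ly /eqP ly']]].
move=> /(congr1 val); rewrite /= !inordK; last 2 first.
- by have := ltn_ord y; lia.
- by have := ltn_ord x; lia.
move=> jl; have xy : x = y :> nat by lia.
by split; congr pair; apply: val_inj => /=; congruence.
Qed.

Lemma dist_energy_cylinder :
  `|energy R (@hex_cylinder n m) - energy R (@hex_torus n m)| <= 2 * n.+1%:R.
Proof.
apply: le_trans (dist_energy_delete_edges _ _ (@hex_torus_sym n m)) _.
by rewrite ler_pM2l// vert_wrap_count.
Qed.

Lemma dist_energy_free :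
  `|energy R (@hex_free n m) - energy R (@hex_torus n m)|
    <= 2 * n.+1%:R + 2 * m.+1%:R.
Proof.
rewrite -(subrK (energy R (@hex_cylinder n m)) (energy R (@hex_free n m))).
rewrite -addrA addrC; apply: le_trans (ler_normD _ _) _.
apply: lerD; first exact: dist_energy_cylinder.
apply: le_trans (dist_energy_delete_edges _ _ _) _.
  exact/delete_edges_sym/hex_torus_sym.
by rewrite ler_pM2l// hor_wrap_count.
Qed.

End HexBoundary.

(** * Passage to the joint limit *)

Section Limit.
Variable R : realType.
Local Notation mu := (@lebesgue_measure R).

Lemma cvg_dist_le (T : Type) (F : set_system T) (f g : T -> R) (l : R) :
  Filter F -> (\forall x \near F, `|f x - l| <= g x) ->
  g x @[x --> F] --> (0 : R) -> f x @[x --> F] --> l.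
Proof.
move=> FF fg g0; apply/cvgrPdist_le => e e0.
near=> x; rewrite distrC; apply: (@le_trans _ _ (g x)); first by near: x.
apply: le_trans (ler_norm _) _; rewrite -normrN -sub0r.
near: x; exact: cvgr_dist_le.
Unshelve. all: by end_near. Qed.

Lemma cvg_succ_ratio : (n.+1%:R / n%:R : R) @[n --> \oo] --> (1 : R).
Proof.
rewrite -(cvg_shiftn 1)/=.
have -> : (fun n : nat => (n + 1).+1%:R / (n + 1)%:R : R) =
    (fun n => 1 + harmonic n).
  by apply/funext => n; rewrite /harmonic addn1 -natr1 mulrDl divff ?pnatr_eq0//
    mul1r.
have := cvgD (cvg_cst (1 : R)) (@cvg_harmonic R).
rewrite addr0; exact.
Qed.

Lemma cvg_sqrt_harmonic (c : R) :
  Num.sqrt (c / n.+1%:R) @[n --> \oo] --> (0 : R).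
Proof.
have h0 : c / n.+1%:R @[n --> \oo] --> (0 : R).
  have := cvgM (cvg_cst c) (@cvg_harmonic R).
  rewrite mulr0; exact.
have := continuous_cvg _ (@sqrt_continuous R 0) h0.
rewrite sqrtr0; exact.
Qed.

Lemma near_prod_gt0 :
  \forall p \near (\oo, \oo), (0 < p.1)%N /\ (0 < p.2)%N.
Proof.
exists ([set n | (0 < n)%N], [set n | (0 < n)%N]) => //.
by split; exact: nbhs_infty_gt.
Qed.

(** Stated for any quantity this close to the torus energy, so that all three boundary conditions
    are instances. *)
Lemma hex_energy_cvg (E : nat -> nat -> R) :
  (forall n m, `|E n m - energy R (@hex_torus n m)| <=
     2 * n.+1%:R + 2 * m.+1%:R) ->
  E p.1 p.2 / (2 * p.1%:R * p.2%:R) @[p --> (\oo, \oo)] -->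
  (4 * pi ^+ 2)^-1 * \int[mu]_(y in `[0, 2 * pi])
     \int[mu]_(x in `[0, 2 * pi]) hex_symbol x y.
Proof.
move=> Eb; set L := (X in _ --> X).
(* The Riemann sum is normalised by (n+1)(m+1) rather than nm; the ratio tends to 1. Since the
   inverse of 0 is 0, the identity also holds for n = 0 or m = 0. *)
have -> : (fun p : nat * nat => E p.1 p.2 / (2 * p.1%:R * p.2%:R)) =
  (fun p => (p.1.+1%:R / p.1%:R) * (p.2.+1%:R / p.2%:R) *
     (E p.1 p.2 / (2 * p.1.+1%:R * p.2.+1%:R))).
  apply/funext => -[n m] /=; rewrite !invfM.
  have := mulfV (_ : n.+1%:R != 0 :> R); have := mulfV (_ : m.+1%:R != 0 :> R).
  rewrite !pnatr_eq0 => /(_ isT) eM /(_ isT) eN.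
  set a := n.+1%:R in eN *; set b := m.+1%:R in eM *.
  rewrite -[LHS]mulr1 -[X in _ * X = _]mulr1 -[X in _ * (X * _) = _]eN.
  rewrite -[X in _ * (_ * X) = _]eM.
  by move: a^-1 b^-1 n%:R^-1 m%:R^-1 2^-1 => a' b' n' m' h; ring.
have fstC : p.1 @[p --> (\oo, \oo)] --> \oo by exact: cvg_fst.
have sndC : p.2 @[p --> (\oo, \oo)] --> \oo by exact: cvg_snd.
suff cL : E p.1 p.2 / (2 * p.1.+1%:R * p.2.+1%:R) @[p --> (\oo, \oo)] --> L.
  have := cvgM (cvgM (cvg_comp _ _ fstC cvg_succ_ratio)
                     (cvg_comp _ _ sndC cvg_succ_ratio)) cL.
  rewrite !mul1r; exact.
(* The harmonic terms are the boundary error (2(n+1) + 2(m+1)) / (2(n+1)(m+1)); the rest is the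
   Riemann sum error. *)
pose g (p : nat * nat) : R := harmonic p.2 + harmonic p.1 +
  2 * (Num.sqrt (2 * pi / p.1.+1%:R) + Num.sqrt (2 * pi / p.2.+1%:R)).
apply: (@cvg_dist_le _ _ _ g).
  near=> p.
  have [n0 m0] : (0 < p.1)%N /\ (0 < p.2)%N by near: p; exact: near_prod_gt0.
  rewrite /g /harmonic /=.
  move: p.1 p.2 n0 m0 (Eb p.1 p.2) => n m n0 m0 {}Eb.
  set K : R := 2 * n.+1%:R * m.+1%:R.
  have K0 : 0 < K by rewrite !mulr_gt0.
  rewrite -(subrK (energy R (@hex_torus n m)) (E n m)) mulrDl -addrA.
  apply: le_trans (ler_normD _ _) _; apply: lerD.
    rewrite normrM (@ger0_norm _ K^-1); last by rewrite invr_ge0 ltW.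
    rewrite ler_pdivrMr//.
    apply: le_trans Eb _; rewrite le_eqVlt; apply/orP; left; apply/eqP.
    by rewrite /K; field; rewrite !nat1r !pnatr_eq0.
  have := hex_riemann_sum R n m; rewrite -/L; apply: le_trans.
  rewrite le_eqVlt; apply/orP; left; apply/eqP; congr (`|_ - _|).
  rewrite energy_torus// /K -[2 * _ * _%:R]mulrA invfM mulrACA divff// mul1r mulrC.
  by [].
have sqrt1 := cvg_comp _ _ fstC (cvg_sqrt_harmonic (2 * pi)).
have sqrt2 := cvg_comp _ _ sndC (cvg_sqrt_harmonic (2 * pi)).
have harm1 := cvg_comp _ _ fstC (@cvg_harmonic R).
have harm2 := cvg_comp _ _ sndC (@cvg_harmonic R).
have := cvgD (cvgD harm2 harm1) (cvgM (cvg_cst (2 : R)) (cvgD sqrt1 sqrt2)).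
rewrite !(addr0, mulr0); exact.
Unshelve. all: by end_near. Qed.

End Limit.

Theorem theorem2p10 (R : realType) :
  let L : R := (4 * pi ^+ 2)^-1 *
    \int[lebesgue_measure]_(y in `[0, 2 * pi])
      \int[lebesgue_measure]_(x in `[0, 2 * pi])
        Num.sqrt (3 + 2 * cos x + 2 * cos y + 2 * cos (x + y)) in
  [/\ energy R (@hex_torus p.1 p.2) / (2 * p.1%:R * p.2%:R)
        @[p --> (\oo, \oo)] --> L,
      energy R (@hex_cylinder p.1 p.2) / (2 * p.1%:R * p.2%:R)
        @[p --> (\oo, \oo)] --> L
    & energy R (@hex_free p.1 p.2) / (2 * p.1%:R * p.2%:R)
        @[p --> (\oo, \oo)] --> L].
Proof.
split.
- apply: (hex_energy_cvg (E := fun n m => energy R (@hex_torus n m))) => n m.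
  by rewrite subrr normr0 addr_ge0 ?mulr_ge0.
- apply: (hex_energy_cvg (E := fun n m => energy R (@hex_cylinder n m))) => n m.
  by apply: le_trans (dist_energy_cylinder R n m) _; rewrite lerDl mulr_ge0.
- apply: (hex_energy_cvg (E := fun n m => energy R (@hex_free n m))) => n m.
  exact: dist_energy_free.
Qed.
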